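(* There is a constant $C$ such that for all $n\ge 1$, $q(n;\mathit{trees})\ge\log^*n-\log^*\log^*n-C$.
   Context: The tower function is $T(0)=1$, $T(i)=2^{T(i-1)}$; $\log^* n=\min\{i: T(i)\ge n\}$. Graphs are simple undirected graphs viewed as structures for the first-order language with adjacency symbol $\sim$ and equality. A sentence defines a finite graph $G$ if it is true on $G$ and false on every graph (of any cardinality) not isomorphic to $G$; $D(G)$ is the minimum quantifier rank of a sentence defining $G$. $q(n;\mathit{trees})=\min\{D(T): T\text{ a tree with } n\text{ vertices}\}$. *)

(* Defs.v *)
From mathcomp Require Import all_boot.
Set Implicit Arguments. Unset Strict Implicit. Unset Printing Implicit Defensive.

Fixpoint tower (i : nat) : nat :=
  match i with 0 => 1 | i'.+1 => 2 ^ tower i' end.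

Lemma tower_gt (i : nat) : i < tower i.
Proof.
elim: i => [|i IH] //=.
apply: (leq_ltn_trans IH); exact: ltn_expl.
Qed.

Lemma logstar_ex (n : nat) : exists i, n <= tower i.
Proof. by exists n; apply: ltnW; apply: tower_gt. Qed.

Definition logstar (n : nat) : nat := ex_minn (logstar_ex n).

(* Variables are de Bruijn indices; quantifiers bind index 0. *)
Inductive form : Type :=
  | FAdj of nat & nat
  | FEq of nat & nat
  | FTrue
  | FFalse
  | FNot of form
  | FAnd of form & form
  | FOr of form & form
  | FImp of form & form
  | FEx of form
  | FAll of form.

Fixpoint qr (f : form) : nat :=
  match f with
  | FAdj _ _ | FEq _ _ | FTrue | FFalse => 0
  | FNot g => qr g
  | FAnd g h | FOr g h | FImp g h => maxn (qr g) (qr h)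
  | FEx g | FAll g => (qr g).+1
  end.

Fixpoint closed_at (k : nat) (f : form) : bool :=
  match f with
  | FAdj i j | FEq i j => (i < k) && (j < k)
  | FTrue | FFalse => true
  | FNot g => closed_at k g
  | FAnd g h | FOr g h | FImp g h => closed_at k g && closed_at k h
  | FEx g | FAll g => closed_at k.+1 g
  end.

Definition sentence (f : form) : bool := closed_at 0 f.

Fixpoint lookup (V : Type) (s : seq V) (i : nat) : option V :=
  match s, i with
  | [::], _ => None
  | x :: _, 0 => Some x
  | _ :: s', i'.+1 => lookup s' i'
  end.

(* Satisfaction in the structure (V, adj) under assignment env.
   Works also for the empty structure. *)
Fixpoint holds (V : Type) (adj : V -> V -> Prop) (env : seq V) (f : form) : Prop :=
  match f with
  | FAdj i j => match lookup env i, lookup env j with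
                | Some a, Some b => adj a b | _, _ => False end
  | FEq i j => match lookup env i, lookup env j with
               | Some a, Some b => a = b | _, _ => False end
  | FTrue => True
  | FFalse => False
  | FNot g => ~ holds adj env g
  | FAnd g h => holds adj env g /\ holds adj env h
  | FOr g h => holds adj env g \/ holds adj env h
  | FImp g h => holds adj env g -> holds adj env h
  | FEx g => exists v : V, holds adj (v :: env) g
  | FAll g => forall v : V, holds adj (v :: env) g
  end.

Definition simple_graph (V : Type) (adj : V -> V -> Prop) : Prop :=
  (forall x y, adj x y -> adj y x) /\ (forall x, ~ adj x x).

Definition graph_iso (V W : Type) (adjV : V -> V -> Prop) (adjW : W -> W -> Prop) : Prop :=
  exists (f : V -> W) (g : W -> V),
    cancel f g /\ cancel g f /\ (forall x y, adjV x y <-> adjW (f x) (f y)).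

Definition defines (phi : form) (V : Type) (adj : V -> V -> Prop) : Prop :=
  sentence phi /\ holds adj [::] phi /\
  forall (W : Type) (adjW : W -> W -> Prop),
    simple_graph adjW -> holds adjW [::] phi -> graph_iso adjW adj.

Definition has_cycle (T : finType) (e : rel T) : Prop :=
  exists (x : T) (p : seq T), 2 <= size p /\ uniq (x :: p) /\ cycle e (x :: p).

Definition is_tree (T : finType) (e : rel T) : Prop :=
  (forall x y, e x y = e y x) /\ (forall x, ~~ e x x) /\
  (forall x y, connect e x y) /\ ~ has_cycle e.

(* Main.v *)
Require Import Defs.
From mathcomp Require Import all_boot zify.
Set Implicit Arguments. Unset Strict Implicit. Unset Printing Implicit Defensive.

(** A piece of a graph is a vertex set [A] joined to its complement only through
    a root [a] of [A].  If a piece [A'] lies strictly inside a piece [A] and the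
    rooted graphs they induce agree up to [k] rounds of the Ehrenfeucht game,
    then putting [A'] in place of [A] (its root taking over the outside
    neighbours of the old one) gives a strictly smaller graph satisfying the
    same sentences of rank [k].  So in a graph defined with rank [k], nested
    pieces have distinct [k]-types.  In a tree every piece with [s >= 2] vertices
    strictly contains a piece with at least [s / 2] vertices, so the number of
    [k]-types exceeds [log2 n]; that number is a tower of height
    [k + log* k + O(1)]. *)

Definition piece (V : finType) (e : rel V) (A : {set V}) (a : V) : Prop :=
  a \in A /\ forall x y, x \in A -> y \notin A -> e x y -> x = a.

(** * Ehrenfeucht types *)

(** Both boards [A] and [A'] lie in the same graph [e]. The list [l] holds the pairs chosen so far
    and has to end as a partial isomorphism. *)
Fixpoint game (V : finType) (e : rel V) (A A' : {set V}) (k : nat)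
    (l : seq (V * V)) : Prop :=
  match k with
  | 0 => forall p q, p \in l -> q \in l ->
           e p.1 q.1 = e p.2 q.2 /\ (p.1 == q.1) = (p.2 == q.2)
  | k'.+1 =>
      (forall x, x \in A -> exists2 x', x' \in A' & game e A A' k' ((x, x') :: l)) /\
      (forall x', x' \in A' -> exists2 x, x \in A & game e A A' k' ((x, x') :: l))
  end.

(** The remaining rounds are spent on idle moves at [a]; a partial isomorphism stays one when pairs
    are dropped. *)
Lemma game_atoms (V : finType) (e : rel V) (A A' : {set V}) (a : V) (k : nat)
    (l : seq (V * V)) :
  a \in A -> game e A A' k l -> game e A A' 0 l.
Proof.
move=> aA; elim: k l => [//|k IH] l [/(_ a aA) [a' _ /IH G] _] p q pl ql.
by apply: G; rewrite inE ?pl ?ql orbT.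
Qed.

(** Hintikka types: at rank 0 the atomic diagram of an [m]-tuple, at higher rank the set of types of
    its one-point extensions. Being a [finType], they can be counted. *)
Fixpoint ty (k m : nat) : finType :=
  match k with
  | 0 => {ffun 'I_m * 'I_m -> bool * bool}
  | k'.+1 => {set ty k' m.+1}
  end.

(** Each rank costs one power set and one more variable, so [m + k] is invariant; at rank 0 every
    ordered pair of variables carries two bits. *)
Lemma card_ty (k m : nat) :
  #|ty k m| = iter k (expn 2) (4 ^ ((m + k) * (m + k))).
Proof.
elim: k m => [|k IH] m.
  by rewrite addn0 /= card_ffun !card_prod card_bool card_ord.
rewrite [LHS]/= -cardsT -powersetT card_powerset cardsT IH.
by rewrite addSnnS.
Qed.

Fixpoint tp (V : finType) (e : rel V) (x0 : V) (A : {set V}) (k m : nat)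
    (env : seq V) : ty k m :=
  match k return ty k m with
  | 0 => [ffun p : 'I_m * 'I_m =>
           (e (nth x0 env p.1) (nth x0 env p.2),
            nth x0 env p.1 == nth x0 env p.2)]
  | k'.+1 => [set tp e x0 A k' m.+1 (v :: env) | v in A]
  end.

Lemma tp_game (V : finType) (e : rel V) (x0 : V) (A A' : {set V}) (k : nat)
    (l : seq (V * V)) :
  tp e x0 A k (size l) (unzip1 l) = tp e x0 A' k (size l) (unzip2 l) ->
  game e A A' k l.
Proof.
elim: k l => [|k IH] l /=.
  move=> E p q pl ql.
  (* A pair of [l] is read off in both diagrams at its own index. *)
  have ip : index p l < size l by rewrite index_mem.
  have iq : index q l < size l by rewrite index_mem.
  move/ffunP/(_ (Ordinal ip, Ordinal iq)): E; rewrite !ffunE /=.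
  by rewrite !(nth_map (x0, x0)) // !nth_index // => -[-> ->].
move=> E; split=> x xA.
  have: tp e x0 A k (size l).+1 (x :: unzip1 l) \in
      [set tp e x0 A' k (size l).+1 (v :: unzip2 l) | v in A'].
    by rewrite -E; apply: imset_f.
  by case/imsetP=> x' x'A /(IH ((x, x') :: l)) G; exists x'.
have: tp e x0 A' k (size l).+1 (x :: unzip2 l) \in
    [set tp e x0 A k (size l).+1 (v :: unzip1 l) | v in A].
  by rewrite E; apply: imset_f.
by case/imsetP=> x' x'A /esym/(IH ((x', x) :: l)) G; exists x'.
Qed.

(** * Replacing a piece by a smaller one *)

Definition repl_adj (V : finType) (e : rel V) (A : {set V}) (a a' : V) : rel V :=
  fun x y =>
    if (x \in A) == (y \in A) then e x y
    else if x \in A then (x == a') && e a y else (y == a') && e a x.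

Definition repl (V : finType) (A A' : {set V}) : Type :=
  {x : V | (x \in A) ==> (x \in A')}.

(** The correspondence kept by the strategy on the whole graphs: the game's pairs inside [A], the
    identity outside. *)
Definition matched (V : finType) (A : {set V}) (l : seq (V * V)) (x x' : V) : bool :=
  if x \in A then (x, x') \in l else x == x'.

Definition matched_env (V : finType) (A A' : {set V}) (l : seq (V * V))
    (env : seq V) (env' : seq (repl A A')) : Prop :=
  forall i, match lookup env i, lookup env' i with
            | Some x, Some x' => matched A l x (val x') : Prop
            | None, None => True
            | _, _ => False
            end.

Lemma matched_env_cons (V : finType) (A A' : {set V}) (l : seq (V * V)) p
    (env : seq V) (env' : seq (repl A A')) x x' :
  matched_env l env env' -> matched A (p :: l) x (val x') ->
  matched_env (p :: l) (x :: env) (x' :: env').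
Proof.
move=> M Mx [|i] //=; move/(_ i): M.
case: (lookup env i) => [y|]; case: (lookup env' i) => [y'|] //.
by rewrite /matched inE; case: ifP => // _ ->; rewrite orbT.
Qed.

(** Inside [A] the game decides, outside nothing changes. An edge leaving [A] starts at [a], and
    since [(a, a')] is in [l], a vertex is [a] exactly when its match is [a']. *)
Lemma matched_atoms (V : finType) (e : rel V) (A A' : {set V}) (a a' : V)
    (l : seq (V * V)) x y x' y' :
  symmetric e -> piece e A a -> A' \subset A ->
  game e A A' 0 l -> (a, a') \in l -> {in l, forall p, p.2 \in A'} ->
  matched A l x x' -> matched A l y y' ->
  e x y = repl_adj e A a a' x' y' /\ (x == y) = (x' == y').
Proof.
move=> se [aA pA] /subsetP sA G al lA'; rewrite /matched /repl_adj.
have l2 z z' : (z, z') \in l -> z' \in A by move/lA'/sA.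
case: ifP => xA; case: ifP => yA.
- move=> xl yl; rewrite (l2 _ _ xl) (l2 _ _ yl) eqxx.
  exact: (G _ _ xl yl).
- move=> xl /eqP <-; rewrite yA (l2 _ _ xl) /=.
  have [_ /= <-] := G _ _ xl al.
  split; last by apply/eqP/eqP => E; [rewrite E yA in xA | move: (l2 _ _ xl); rewrite E yA].
  case: eqP => [->//|ne]; apply/negP => exy.
  by case: ne; apply: pA exy; rewrite ?yA.
- move=> /eqP <- yl; rewrite xA (l2 _ _ yl) /=.
  have [_ /= <-] := G _ _ yl al.
  split; last by apply/eqP/eqP => E; [rewrite -E xA in yA | move: (l2 _ _ yl); rewrite -E xA].
  rewrite se; case: eqP => [->//|ne]; apply/negP => exy.
  by case: ne; apply: pA exy; rewrite ?xA.
- by move=> /eqP <- /eqP <-; rewrite xA yA.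
Qed.

(** The strategy between [A] and [A'] is extended by the identity outside [A]; [forth] and [back]
    answer a quantifier in either graph. The position [l] is separate from the environments, as it
    also holds the root pair and idle moves. *)
Lemma holds_repl (V : finType) (e : rel V) (A A' : {set V}) (a a' : V) f k
    (l : seq (V * V)) (env : seq V) (env' : seq (repl A A')) :
  symmetric e -> piece e A a -> a' \in A' -> A' \subset A ->
  qr f <= k -> game e A A' k l -> (a, a') \in l ->
  {in l, forall p, p.2 \in A'} -> matched_env l env env' ->
  holds (fun x y => e x y) env f <->
  holds (fun x y : repl A A' => repl_adj e A a a' (val x) (val y)) env' f.
Proof.
move=> se pA a'A' sA; have aA := proj1 pA.
have lA'_cons (l0 : seq (V * V)) x x' : x' \in A' ->
    {in l0, forall p, p.2 \in A'} -> {in (x, x') :: l0, forall p, p.2 \in A'}.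
  by move=> x'A' lA' p; rewrite inE => /orP[/eqP->|/lA'].
have al_cons p (l0 : seq (V * V)) : (a, a') \in l0 -> (a, a') \in p :: l0.
  by rewrite inE orbC => ->.
have forth k0 l0 env0 (env0' : seq (repl A A')) v :
    game e A A' k0.+1 l0 -> {in l0, forall p, p.2 \in A'} ->
    matched_env l0 env0 env0' ->
    exists (w : repl A A') p, [/\ game e A A' k0 (p :: l0),
      {in p :: l0, forall p, p.2 \in A'} &
      matched_env (p :: l0) (v :: env0) (w :: env0')].
  move=> [G _] lA' M; case vA: (v \in A).
    have [v' v'A' G'] := G _ vA.
    have v'W : (v' \in A) ==> (v' \in A') by rewrite v'A' implybT.
    exists (Sub v' v'W), (v, v'); split=> //; first exact: lA'_cons.
    by apply: matched_env_cons => //; rewrite /matched vA SubK mem_head.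
  (* a move outside [A] is answered by itself, and counts in the game between
     [A] and [A'] as an idle move on the root *)
  have [v' v'A' G'] := G _ aA.
  have vW : (v \in A) ==> (v \in A') by rewrite vA.
  exists (Sub v vW), (a, v'); split=> //; first exact: lA'_cons.
  by apply: matched_env_cons => //; rewrite /matched vA SubK.
have back k0 l0 env0 (env0' : seq (repl A A')) (w : repl A A') :
    game e A A' k0.+1 l0 -> {in l0, forall p, p.2 \in A'} ->
    matched_env l0 env0 env0' ->
    exists v p, [/\ game e A A' k0 (p :: l0),
      {in p :: l0, forall p, p.2 \in A'} &
      matched_env (p :: l0) (v :: env0) (w :: env0')].
  move=> [G G2] lA' M; case wA: (val w \in A).
    have wA' : val w \in A' by move: (valP w); rewrite wA.
    have [v vA G'] := G2 _ wA'.
    exists v, (v, val w); split=> //; first exact: lA'_cons.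
    by apply: matched_env_cons => //; rewrite /matched vA mem_head.
  have [v' v'A' G'] := G _ aA.
  exists (val w), (a, v'); split=> //; first exact: lA'_cons.
  by apply: matched_env_cons => //; rewrite /matched wA.
elim: f k l env env' => [i j|i j|||f IH|f IHf g IHg|f IHf g IHg|f IHf g IHg|f IH|f IH]
  k l env env' /= qk G al lA' M.
- move: (M i) (M j).
  case: (lookup env i) => [x|]; case: (lookup env' i) => [x'|] //.
  case: (lookup env j) => [y|]; case: (lookup env' j) => [y'|] // Mx My.
  by have [-> _] := matched_atoms se pA sA (game_atoms aA G) al lA' Mx My.
- move: (M i) (M j).
  case: (lookup env i) => [x|]; case: (lookup env' i) => [x'|] //.
  case: (lookup env j) => [y|]; case: (lookup env' j) => [y'|] // Mx My.
  have [_ E] := matched_atoms se pA sA (game_atoms aA G) al lA' Mx My.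
  split=> xy; first by apply/val_inj/eqP; rewrite -E xy.
  by apply/eqP; rewrite E xy.
- by [].
- by [].
- by have := IH k l env env' qk G al lA' M; tauto.
- move: qk; rewrite geq_max => /andP[qf qg].
  have := IHf k l env env' qf G al lA' M; have := IHg k l env env' qg G al lA' M; tauto.
- move: qk; rewrite geq_max => /andP[qf qg].
  have := IHf k l env env' qf G al lA' M; have := IHg k l env env' qg G al lA' M; tauto.
- move: qk; rewrite geq_max => /andP[qf qg].
  have := IHf k l env env' qf G al lA' M; have := IHg k l env env' qg G al lA' M; tauto.
- case: k qk G => // k qk G; split.
    case=> v hv; have [w [p [G' lp M']]] := forth _ _ _ _ v G lA' M.
    by exists w; apply/(IH k _ _ _ qk G' (al_cons p l al) lp M').
  case=> w hw; have [v [p [G' lp M']]] := back _ _ _ _ w G lA' M.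
  by exists v; apply/(IH k _ _ _ qk G' (al_cons p l al) lp M').
- case: k qk G => // k qk G; split.
    move=> h w; have [v [p [G' lp M']]] := back _ _ _ _ w G lA' M.
    by apply/(IH k _ _ _ qk G' (al_cons p l al) lp M').
  move=> h v; have [w [p [G' lp M']]] := forth _ _ _ _ v G lA' M.
  by apply/(IH k _ _ _ qk G' (al_cons p l al) lp M').
Qed.

(** With equal types the replaced graph would satisfy [phi], hence be isomorphic to the original,
    though it has fewer vertices. *)
Lemma defines_tp_neq (V : finType) (e : rel V) (x0 : V) phi (A A' : {set V}) (a a' : V) :
  symmetric e -> irreflexive e -> defines phi (fun x y => e x y) ->
  piece e A a -> piece e A' a' -> A' \proper A ->
  tp e x0 A (qr phi) 1 [:: a] != tp e x0 A' (qr phi) 1 [:: a'].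
Proof.
move=> se ie [_ [h uniq_phi]] pA [a'A' _] /properP[sA [z zA zA']].
apply/eqP => /(@tp_game _ e x0 A A' (qr phi) [:: (a, a')]) G.
have lA' : {in [:: (a, a')], forall p, p.2 \in A'} by move=> p; rewrite inE => /eqP->.
have M : @matched_env V A A' [:: (a, a')] [::] [::] by case.
have E := holds_repl se pA a'A' sA (leqnn _) G (mem_head _ _) lA' M.
have [] := uniq_phi (repl A A')
    (fun x y : repl A A' => repl_adj e A a a' (val x) (val y)).
- split=> [x y|x]; last by rewrite /repl_adj eqxx ie.
  rewrite /repl_adj eq_sym se; case: ifP => // ne.
  by move: ne; case: (_ \in A); case: (_ \in A).
- exact/E.
move=> f [g [_ [gK _]]].
(* The isomorphism followed by the inclusion is an injection of the finite set [V] into itself,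
   hence onto, yet it misses [z]. *)
have inj : injective (fun v => val (g v)) by move=> x y /val_inj/(can_inj gK).
have [v zE] : exists v, val (g v) = z.
  by exists (invF inj z); apply: (f_invF inj).
by move: (valP (g v)); rewrite zE zA (negPf zA').
Qed.

(** * Pieces of trees *)

(** Otherwise a simple path from [b] to [c] inside [D] would close up through [a] into a cycle. *)
Lemma connect_not_cycle (V : finType) (e : rel V) (a b c : V) (D : {set V}) :
  symmetric e -> ~ has_cycle e -> a \notin D -> b \in D -> e a b -> e a c ->
  connect (fun x y => [&& e x y, x \in D & y \in D]) b c -> c = b.
Proof.
move=> se nc aD bD eab eac /connectP[p pth cE].
apply/eqP; apply/negPn/negP => cb; apply: nc.
case/shortenP: pth cE => p' pth' up' _ cE.
exists a, (b :: p'); split=> //.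
  by case: p' cE {pth' up'} => [|//] /= E; rewrite E eqxx in cb.
have sD : all (mem D) p'.
  by elim: p' b bD pth' {up' cE cb eab} => //= y p' IH b bD /andP[/and3P[_ _ yD] /IH->]; rewrite ?yD.
split.
  rewrite /= in up' *; rewrite up' andbT inE negb_or; apply/andP; split.
    by apply: contraNneq aD => ->.
  by apply: contra aD => /(allP sD).
rewrite /= eab rcons_path -cE se eac andbT.
by apply: sub_path pth' => x y /and3P[].
Qed.

(** Let [D] be the component of a neighbour [b] of [a] in [A] minus [a]. Either [D] is everything
    but [a] and is a piece rooted at [b], or [A] is covered by two proper pieces rooted at [a], one
    of which has at least half of the vertices. *)
Lemma tree_subpiece (V : finType) (e : rel V) (A : {set V}) (a : V) :
  is_tree e -> piece e A a -> 1 < #|A| ->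
  exists B b, [/\ piece e B b, B \proper A & #|A| <= #|B|.*2].
Proof.
move=> [se [ie [ce nc]]] [aA pA] A1.
have [x xA xa] : exists2 x, x \in A & x != a.
  case/card_gt1P: A1 => x [y [xA yA xy]].
  by case: (eqVneq x a) => [xE|]; [exists y; rewrite // -xE eq_sym | exists x].
have [b /andP[bA eab]] : exists b, (b \in A) && e a b.
  case: (pickP (fun b => (b \in A) && e a b)) => [b|nb]; first by exists b.
  (* Without such a neighbour, [A] minus [a] would be a union of components, against
     connectedness. *)
  have cl : closed e [predD1 A & a].
    apply: intro_closed; first exact: sym_connect_sym.
    move=> u v euv; rewrite !inE => /andP[ua uA].
    have vA : v \in A.
      by apply/negPn/negP => /(pA _ _ uA)/(_ euv) E; rewrite E eqxx in ua.
    rewrite vA andbT; apply/eqP => E.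
    by move: (nb u); rewrite uA -E se euv.
  by have := closed_connect cl (ce x a); rewrite !inE eqxx xa xA.
have ba : b != a by apply: contraTneq eab => ->; apply: ie.
pose r := fun x y => [&& e x y, x \in A :\ a & y \in A :\ a].
pose D := [set y | connect r b y].
have bAa : b \in A :\ a by rewrite !inE ba.
have sD : D \subset A :\ a.
  apply/subsetP => y; rewrite inE => /connectP[p pth ->].
  elim: p b bAa pth {eab ba bA D} => //= y' p IH b bAa /andP[/and3P[_ _ y'A]].
  exact: IH.
have clD u v : u \in D -> v \in A :\ a -> e u v -> v \in D.
  move=> uD vA euv; have uA := subsetP sD _ uD; move: uD; rewrite !inE => bu.
  by apply: connect_trans bu (connect1 _); rewrite /r euv uA vA.
have bD : b \in D by rewrite inE connect0.
have sDA : D \subset A by apply: subset_trans sD (subD1set _ _).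
have cA : #|A| = #|A :\ a|.+1 by rewrite (cardsD1 a) aA.
have aD : a \notin D by apply/negP => /(subsetP sD); rewrite !inE eqxx.
case: (eqVneq D (A :\ a)) => [DE|nDE].
  exists (A :\ a), b; split; last 1 first.
  - by lia.
  - split=> // u v uA vA euv.
    have [ua uA'] : u != a /\ u \in A by move: uA; rewrite !inE => /andP[].
    have va : v = a.
      apply/eqP/negPn/negP => va; move: vA; rewrite !inE va /= => vA.
      by move/eqP: ua; apply; apply: pA euv.
    have aAa : a \notin A :\ a by rewrite !inE eqxx.
    (* By acyclicity [b] is the only neighbour of [a] in [D]. *)
    apply: (connect_not_cycle se nc aAa bAa eab); first by rewrite se -va.
    by have: u \in D by [rewrite DE]; rewrite inE.
  - by rewrite properE subD1set /=; apply/subsetPn; exists a; rewrite // !inE eqxx.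
have [y yA yD] : exists2 y, y \in A :\ a & y \notin D.
  by apply/subsetPn; apply: contra nDE => s; rewrite eqEsubset sD.
have p1 : piece e (a |: D) a.
  split=> [|u v]; first exact: setU11.
  rewrite !in_setU1 negb_or => /orP[/eqP//|uD] /andP[va vD] euv.
  apply: pA (euv); first exact: (subsetP sDA).
  by apply: contra vD => vA; apply: clD uD _ euv; rewrite in_setD1 va.
have p2 : piece e (A :\: D) a.
  split=> [|u v]; first by rewrite in_setD aD aA.
  rewrite !in_setD negb_and negbK => /andP[uD uA] /orP[vD|vA] euv; last exact: pA euv.
  apply/eqP/negPn/negP => ua; move/negP: uD; apply.
  by apply: clD vD _ _; rewrite ?in_setD1 ?ua // se.
have s1 : a |: D \proper A.
  rewrite properE subUset sub1set aA sDA /=; apply/subsetPn; exists y.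
    by move: yA; rewrite in_setD1 => /andP[].
  by move: yA; rewrite in_setD1 in_setU1 (negPf yD) orbF => /andP[].
have s2 : A :\: D \proper A.
  rewrite properE subsetDl /=; apply/subsetPn; exists b => //.
  by rewrite in_setD bD.
have c1 : #|a |: D| = #|D|.+1 by rewrite cardsU1 aD.
have c2 : #|A :\: D| = #|A| - #|D| by rewrite cardsD (setIidPr sDA).
have := subset_leq_card sDA.
(* The two pieces share only [a], so their sizes add up to [#|A| + 1]. *)
case: (leqP #|A| #|a |: D|.*2) => h h'; first by exists (a |: D), a.
exists (A :\: D), a; split=> //; rewrite c2.
by move: c1 h h'; move: #|_| #|D| #|A|; clear; lia.
Qed.

(** Repeated halving gives a chain of [m + 1] nested pieces, whose types are pairwise distinct. *)
Lemma tree_types (V : finType) (e : rel V) (K : finType)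
    (t : {set V} -> V -> K) (A : {set V}) (a : V) (m : nat) :
  is_tree e ->
  (forall A a B b, piece e A a -> piece e B b -> B \proper A -> t A a != t B b) ->
  piece e A a -> 2 ^ m <= #|A| -> m < #|K|.
Proof.
move=> te tneq pA Am.
(* Recording that the types in [S] come from pieces inside [A] makes the type of any strictly larger
   piece new. *)
suff [S [mS _]] : exists S : {set K}, m < #|S| /\ {in S, forall c, exists B b,
    [/\ piece e B b, B \subset A & c = t B b]}.
  exact: leq_trans mS (max_card _).
elim: m A a pA Am => [|m IH] A a pA Am.
  exists [set t A a]; rewrite cards1; split=> // c /set1P->.
  by exists A, a.
have m0 := expn_gt0 2 m.
move: Am; rewrite expnS => Am.
have [B [b [pB sBA cB]]] : exists B b,
    [/\ piece e B b, B \proper A & #|A| <= #|B|.*2].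
  by apply: tree_subpiece pA _ => //; lia.
have [S [mS HS]] := IH B b pB ltac:(lia).
exists (t A a |: S); split.
  rewrite cardsU1; suff -> : t A a \notin S by [].
  apply/negP => /HS[B' [b' [pB' sB' E]]].
  have := tneq A a B' b' pA pB' (sub_proper_trans sB' sBA).
  by rewrite E eqxx.
move=> c /setU1P[->|/HS[B' [b' [pB' sB' ->]]]]; first by exists A, a.
exists B', b'; split=> //.
exact: subset_trans sB' (proper_sub sBA).
Qed.

Lemma tree_order_bound (n : nat) (e : rel 'I_n) phi :
  is_tree e -> defines phi (fun x y : 'I_n => e x y) ->
  n < 2 ^ #|ty (qr phi) 1|.
Proof.
(* The empty graph has no vertex to serve as a root; otherwise the whole vertex set is a piece
   rooted at [ord0]. *)
case: n e => [|n] e te dphi; first by rewrite expn_gt0.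
rewrite ltnNge; apply/negP => h.
have [se [ie _]] := te.
suff: #|ty (qr phi) 1| < #|ty (qr phi) 1| by rewrite ltnn.
apply: (@tree_types _ e _ (fun A a => tp e ord0 A (qr phi) 1 [:: a]) setT ord0) => //.
- move=> A a B b pA pB sBA; apply: defines_tp_neq pA pB sBA => //.
  by move=> x; apply/negbTE.
- by split=> [|x y _]; rewrite inE.
- by rewrite cardsT card_ord.
Qed.

(** * Towers *)

Lemma leq_iter_exp2 (k m n : nat) : m <= n -> iter k (expn 2) m <= iter k (expn 2) n.
Proof. by move=> mn; elim: k => //= k IH; rewrite leq_exp2l. Qed.

Lemma iter_exp2_tower (k j : nat) : iter k (expn 2) (tower j) = tower (k + j).
Proof. by elim: k => //= k ->. Qed.

Lemma logstarP (n : nat) : n <= tower (logstar n).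
Proof. by rewrite /logstar; case: ex_minnP. Qed.

Lemma logstar_leq (n i : nat) : n <= tower i -> logstar n <= i.
Proof. by rewrite /logstar; case: ex_minnP => m _ min_m /min_m. Qed.

Lemma logstar_mono (m n : nat) : m <= n -> logstar m <= logstar n.
Proof. by move=> mn; apply/logstar_leq/(leq_trans mn)/logstarP. Qed.

(** The exponent satisfies [2 * (k + 1) ^ 2 <= 2 ^ (2 * k + 1)], and
    [2 * k + 1 <= 2 ^ (k + 1) <= 2 ^ (2 ^ k)]. *)
Lemma exp4_sqr_bound (k : nat) : 4 ^ (k.+1 * k.+1) <= iter 4 (expn 2) k.
Proof.
apply: (@leq_trans (2 ^ (2 * (k.+1 * k.+1)))); first by rewrite (expnM 2 2).
rewrite [iter _ _ _]/= leq_exp2l //.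
have k2 : k.+1 <= 2 ^ k by apply: ltn_expl.
apply: (@leq_trans (2 ^ (k + k).+1)).
  by rewrite expnS expnD leq_mul2l leq_mul.
rewrite leq_exp2l //; apply: (@leq_trans (2 ^ k.+1)); last by rewrite leq_exp2l.
by rewrite expnS; lia.
Qed.

Theorem theorem8p1 :
  exists C : nat, forall n : nat, 1 <= n ->
    forall e : rel 'I_n, is_tree e ->
    forall phi : form, defines phi (fun x y : 'I_n => e x y) ->
      logstar n <= qr phi + logstar (logstar n) + C.
Proof.
(* One exponential comes from [tree_order_bound] and four from [exp4_sqr_bound]. *)
exists 5 => n _ e te phi dphi; set k := qr phi.
have : n <= tower (k.+1 + (4 + logstar k)).
  apply: leq_trans (ltnW (tree_order_bound te dphi)) _.
  rewrite card_ty -[X in X <= _]/(iter k.+1 (expn 2) _) -iter_exp2_tower.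
  apply: leq_iter_exp2; rewrite -iter_exp2_tower add1n.
  apply: leq_trans (exp4_sqr_bound k) _.
  exact/leq_iter_exp2/logstarP.
move/logstar_leq => h.
(* If [k <= logstar n], then [logstar k] is at most [logstar (logstar n)]; otherwise [k] alone
   exceeds [logstar n]. *)
case: (leqP k (logstar n)) => [/logstar_mono|]; lia.
Qed.
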